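(* Let $\mathcal{A},\mathcal{B}$ be Boolean subalgebras of $\mathcal{P}(\omega)/\mathrm{fin}$ and let $f:\mathcal{A}\to\mathcal{B}$ be an isomorphism of Boolean algebras. If $|\mathcal{A}|<\mathfrak{p}$ and $\mathcal{A}$ has an independent basis, then $f$ is generated by a permutation of $\omega$.
   Context: $\mathcal{P}(\omega)/\mathrm{fin}$ is the Boolean algebra of classes of subsets of $\omega$ modulo the ideal of finite sets. A family $\mathcal{S}$ of subsets of $\omega$ is independent if for all $n,m\in\omega$ and all distinct $A_1,\dots,A_{n+m}\in\mathcal{S}$ the intersection $A_1\cap\dots\cap A_n\cap(\omega\setminus A_{n+1})\cap\dots\cap(\omega\setminus A_{n+m})$ is nonempty. Independence of a subfamily of $\mathcal{P}(\omega)/\mathrm{fin}$ is understood in the same sense: every such finite Boolean combination (meet of finitely many members and complements of finitely many other members, all distinct) is nonzero in $\mathcal{P}(\omega)/\mathrm{fin}$. An independent basis of a subalgebra $\mathcal{A}$ is an independent subfamily of $\mathcal{A}$ that generates $\mathcal{A}$ as a Boolean algebra. An isomorphism $f:\mathcal{A}\to\mathcal{B}$ between two subalgebras of $\mathcal{P}(\omega)/\mathrm{fin}$ is generated by a permutation (bijection) $\pi:\omega\to\omega$ if for every $a\in\mathcal{A}$ and every set $A\subseteq\omega$ with $A\in a$ one has $\pi(A)\in f(a)$. For $A,B\subseteq\omega$, $A\subseteq^* B$ means that $A\setminus B$ is finite. A family $\mathcal{F}$ of subsets of $\omega$ has the strong finite intersection property (sfip) if every nonempty finite subfamily has infinite intersection.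 A pseudointersection of $\mathcal{F}$ is an infinite set $H\subseteq\omega$ with $H\subseteq^* F$ for all $F\in\mathcal{F}$. The cardinal $\mathfrak{p}$ is the minimal cardinality of a family of subsets of $\omega$ that has sfip but has no (infinite) pseudointersection. *)

(* Defs.v *)
From HB Require Import structures.
From mathcomp Require Import all_boot all_order.
From mathcomp Require Import boolp classical_sets functions cardinality.
Set Implicit Arguments.
Unset Strict Implicit.
Unset Printing Implicit Defensive.
Import Order.TTheory.
Local Open Scope quotient_scope.
Local Open Scope classical_set_scope.
Local Open Scope card_scope.

Reserved Notation "A `<=*` B" (at level 70, no associativity).

Definition almost_subset (A B : set nat) : Prop := finite_set (A `\` B).
Notation "A `<=*` B" := (almost_subset A B) : classical_set_scope.

Definition almost_equal (A B : set nat) : bool :=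
  `[< A `<=*` B /\ B `<=*` A >].

Lemma almost_equal_refl : reflexive almost_equal.
Proof. by move=> A; apply/asboolP; rewrite /almost_subset setDv. Qed.

Lemma almost_equal_sym : symmetric almost_equal.
Proof. by move=> A B; apply/asboolP/asboolP=> -[]. Qed.

Lemma almost_subset_trans A B C : A `<=*` B -> B `<=*` C -> A `<=*` C.
Proof.
move=> AB BC; apply: (@sub_finite_set _ _ ((A `\` B) `|` (B `\` C))).
  by move=> x [Ax nCx]; case: (pselect (B x)) => Bx; [right|left].
by rewrite finite_setU.
Qed.

Lemma almost_equal_trans : transitive almost_equal.
Proof.
move=> B A C /asboolP[AB BA] /asboolP[BC CB]; apply/asboolP; split.
  exact: almost_subset_trans AB BC.
exact: almost_subset_trans CB BA.
Qed.

Canonical almost_equal_equiv :=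
  EquivRel almost_equal almost_equal_refl almost_equal_sym almost_equal_trans.

(* The carrier of P(omega)/fin; the class of [A] is [\pi_Pfin A]. *)
Definition Pfin := {eq_quot almost_equal}.
HB.instance Definition _ := Choice.on Pfin.
HB.instance Definition _ := EqQuotient.on Pfin.

Lemma Pfin_eqP (A B : set nat) :
  \pi_Pfin A = \pi_Pfin B <-> A `<=*` B /\ B `<=*` A.
Proof. by split=> [/eqmodP/asboolP|AB]; last exact/eqmodP/asboolP. Qed.

Fact Pfin_display : Order.disp_t. Proof. by []. Qed.

Module PfinOrder.

Definition bot : Pfin := \pi_Pfin set0.
Definition top : Pfin := \pi_Pfin setT.
Definition meet (a b : Pfin) : Pfin := \pi_Pfin (repr a `&` repr b).
Definition join (a b : Pfin) : Pfin := \pi_Pfin (repr a `|` repr b).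
Definition compl (a : Pfin) : Pfin := \pi_Pfin (~` repr a).
Definition le (a b : Pfin) : bool := meet a b == a.
Definition lt (a b : Pfin) : bool := (b != a) && le a b.

Lemma repr_pi (A : set nat) :
  repr (\pi_Pfin A) `<=*` A /\ A `<=*` repr (\pi_Pfin A).
Proof. by apply/Pfin_eqP; rewrite reprK. Qed.

Lemma meetE A B : meet (\pi_Pfin A) (\pi_Pfin B) = \pi_Pfin (A `&` B).
Proof.
have [A1 A2] := repr_pi A; have [B1 B2] := repr_pi B.
apply/Pfin_eqP; split.
- apply: (sub_finite_set _ (_ : finite_set (_ `|` _))); last first.
    by rewrite finite_setU; split; [exact: A1|exact: B1].
  by move=> x [[? ?]] /not_andP[]; [left|right].
- apply: (sub_finite_set _ (_ : finite_set (_ `|` _))); last first.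
    by rewrite finite_setU; split; [exact: A2|exact: B2].
  by move=> x [[? ?]] /not_andP[]; [left|right].
Qed.

Lemma complE A : compl (\pi_Pfin A) = \pi_Pfin (~` A).
Proof.
have [A1 A2] := repr_pi A.
by apply/Pfin_eqP; rewrite /almost_subset !setDE !setCK ![~` _ `&` _]setIC.
Qed.

Lemma joinE A B : join (\pi_Pfin A) (\pi_Pfin B) = \pi_Pfin (A `|` B).
Proof.
have [A1 A2] := repr_pi A; have [B1 B2] := repr_pi B.
apply/Pfin_eqP; split.
- apply: (sub_finite_set _ (_ : finite_set (_ `|` _))); last first.
    by rewrite finite_setU; split; [exact: A1|exact: B1].
  by move=> x [[?|?]] /not_orP[? ?]; [left|right].
- apply: (sub_finite_set _ (_ : finite_set (_ `|` _))); last first.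
    by rewrite finite_setU; split; [exact: A2|exact: B2].
  by move=> x [[?|?]] /not_orP[? ?]; [left|right].
Qed.

Lemma meetC : commutative meet.
Proof. by elim/quotW=> A; elim/quotW=> B; rewrite !meetE setIC. Qed.

Lemma joinC : commutative join.
Proof. by elim/quotW=> A; elim/quotW=> B; rewrite !joinE setUC. Qed.

Lemma meetA : associative meet.
Proof.
elim/quotW=> A; elim/quotW=> B; elim/quotW=> C.
by rewrite (meetE B C) (meetE A B) !meetE setIA.
Qed.

Lemma joinA : associative join.
Proof.
elim/quotW=> A; elim/quotW=> B; elim/quotW=> C.
by rewrite (joinE B C) (joinE A B) !joinE setUA.
Qed.

Lemma joinKI b a : meet a (join a b) = a.
Proof.
by elim/quotW: b => B; elim/quotW: a => A; rewrite (joinE A B) meetE setUC setKU.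
Qed.

Lemma meetKU b a : join a (meet a b) = a.
Proof.
by elim/quotW: b => B; elim/quotW: a => A; rewrite (meetE A B) joinE setIC setKI.
Qed.

Lemma meetUl : left_distributive meet join.
Proof.
elim/quotW=> A; elim/quotW=> B; elim/quotW=> C.
by rewrite (joinE A B) (meetE A C) (meetE B C) meetE joinE setIUl.
Qed.

Lemma meetxx : idempotent_op meet.
Proof. by elim/quotW=> A; rewrite meetE setIid. Qed.

Lemma le_def a b : le a b = (meet a b == a). Proof. by []. Qed.

Lemma lt_def a b : lt a b = (b != a) && le a b. Proof. by []. Qed.

End PfinOrder.

HB.instance Definition _ :=
  Order.isMeetJoinDistrLattice.Build Pfin_display Pfin
    PfinOrder.le_def PfinOrder.lt_def PfinOrder.meetC PfinOrder.joinC
    PfinOrder.meetA PfinOrder.joinA PfinOrder.joinKI PfinOrder.meetKU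
    PfinOrder.meetUl PfinOrder.meetxx.

Fact Pfin_le0x (a : Pfin) : (PfinOrder.bot <= a)%O.
Proof.
elim/quotW: a => A; rewrite leEmeet; apply/eqP.
by rewrite [LHS]PfinOrder.meetE set0I.
Qed.

Fact Pfin_lex1 (a : Pfin) : (a <= PfinOrder.top)%O.
Proof.
elim/quotW: a => A; rewrite leEmeet; apply/eqP.
by rewrite [LHS]PfinOrder.meetE setIT.
Qed.

HB.instance Definition _ := Order.hasBottom.Build Pfin_display Pfin Pfin_le0x.
HB.instance Definition _ := Order.hasTop.Build Pfin_display Pfin Pfin_lex1.

Fact Pfin_joinxC (a : Pfin) : (a `|` PfinOrder.compl a)%O = \top%O.
Proof.
elim/quotW: a => A; rewrite PfinOrder.complE.
by rewrite [LHS]PfinOrder.joinE setUCr.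
Qed.

Fact Pfin_meetxC (a : Pfin) : (a `&` PfinOrder.compl a)%O = \bot%O.
Proof.
elim/quotW: a => A; rewrite PfinOrder.complE.
by rewrite [LHS]PfinOrder.meetE setICr.
Qed.

HB.instance Definition _ :=
  Order.TBDistrLattice_hasComplement.Build Pfin_display Pfin
    Pfin_joinxC Pfin_meetxC.

Lemma Pfin_meetE (A B : set nat) :
  (\pi_Pfin A `&` \pi_Pfin B)%O = \pi_Pfin (A `&` B).
Proof. exact: PfinOrder.meetE. Qed.

Lemma Pfin_joinE (A B : set nat) :
  (\pi_Pfin A `|` \pi_Pfin B)%O = \pi_Pfin (A `|` B).
Proof. exact: PfinOrder.joinE. Qed.

Lemma Pfin_complE (A : set nat) : (~` \pi_Pfin A)%O = \pi_Pfin (~` A).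
Proof. exact: PfinOrder.complE. Qed.

Lemma Pfin_botE : \bot%O = \pi_Pfin set0. Proof. by []. Qed.

Lemma Pfin_topE : \top%O = \pi_Pfin setT. Proof. by []. Qed.

Record subalgebra d (T : ctbDistrLatticeType d) (A : set T) : Prop :=
  Subalgebra {
    subalgebra0 : A \bot%O;
    subalgebra1 : A \top%O;
    subalgebraI : forall x y, A x -> A y -> A (x `&` y)%O;
    subalgebraU : forall x y, A x -> A y -> A (x `|` y)%O;
    subalgebraC : forall x, A x -> A (~` x)%O }.

Definition generated_subalgebra d (T : ctbDistrLatticeType d) (S : set T) :
  set T := smallest (@subalgebra d T) S.

Definition independent d (T : ctbDistrLatticeType d) (S : set T) : Prop :=
  forall s t : seq T, uniq (s ++ t) -> (forall x, x \in s ++ t -> S x) ->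
    ((\meet_(x <- s) x) `&` (\meet_(x <- t) ~` x))%O != \bot%O.

Definition independent_basis d (T : ctbDistrLatticeType d) (A S : set T) :
  Prop := [/\ S `<=` A, independent S & generated_subalgebra S = A].

(* A map between the subalgebras [A] and [B] is the restriction to [A] of a
   total function; its values outside [A] are irrelevant. *)
Record subalgebra_isomorphism d1 (T1 : ctbDistrLatticeType d1)
    d2 (T2 : ctbDistrLatticeType d2) (A : set T1) (B : set T2) (f : T1 -> T2) :
  Prop := SubalgebraIsomorphism {
    subalgebra_iso_bij : set_bij A B f;
    subalgebra_iso0 : f \bot%O = \bot%O;
    subalgebra_iso1 : f \top%O = \top%O;
    subalgebra_isoI :
      forall x y, A x -> A y -> f (x `&` y)%O = (f x `&` f y)%O;
    subalgebra_isoU :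
      forall x y, A x -> A y -> f (x `|` y)%O = (f x `|` f y)%O;
    subalgebra_isoC : forall x, A x -> f (~` x)%O = (~` f x)%O }.

(* [\pi_Pfin X = a] says that [X] belongs to the class [a]. *)
Definition generated_by_permutation (A : set Pfin) (f : Pfin -> Pfin)
    (p : nat -> nat) : Prop :=
  bijective p /\
  forall (a : Pfin) (X : set nat), A a -> \pi_Pfin X = a ->
    \pi_Pfin (p @` X) = f a.

Definition sfip (F : set (set nat)) : Prop :=
  forall G : set (set nat), G `<=` F -> finite_set G -> G !=set0 ->
    infinite_set (\bigcap_(X in G) X).

Definition pseudointersection (F : set (set nat)) (H : set nat) : Prop :=
  infinite_set H /\ forall X, F X -> H `<=*` X.

Definition card_lt T U (A : set T) (B : set U) : Prop :=
  A #<= B /\ ~ (B #<= A).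

Definition sfip_without_pseudointersection (F : set (set nat)) : Prop :=
  sfip F /\ ~ exists H, pseudointersection F H.

(* The cardinal p is represented by the families that realize it. *)
Definition cardinal_p : set (set (set nat)) :=
  [set F | sfip_without_pseudointersection F /\
    forall G, sfip_without_pseudointersection G -> F #<= G].

Definition card_lt_p T (A : set T) : Prop :=
  exists2 F, cardinal_p F & card_lt A F.

(* Main.v *)
(* Pick representatives [X a], [Y a] of [a] and [f a] for [a] in the basis [S];
   by independence every finite pattern of memberships occurs infinitely often
   on either side.  Given [n], the sets [Y a] or their complements, chosen as
   [n] lies in [X a] or not, thus have the sfip, hence a pseudointersection
   [H n].  Since fewer than p functions are dominated by a single one, we can
   send each [n] so far into [H n] that every [a] is violated only finitely
   often.  This gives an injection carrying [X a] to [Y a] up to finite sets, and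
   symmetrically one going back; a Cantor-Bernstein bijection built from the two
   is the desired permutation, because the elements of [A] on which it induces
   [f] form a subalgebra containing [S]. *)
Require Import Defs.
From mathcomp Require Import all_boot all_order.
From mathcomp Require Import boolp classical_sets functions cardinality.
Set Implicit Arguments.
Unset Strict Implicit.
Unset Printing Implicit Defensive.
Local Open Scope quotient_scope.
Local Open Scope classical_set_scope.
Local Open Scope card_scope.

(** * Finite and infinite sets of natural numbers *)

Lemma finite_natP (A : set nat) :
  finite_set A <-> exists N, forall n, A n -> n < N.
Proof.
split=> [/finite_seqP[s ->]|[N AN]]; last exact: sub_finite_set (finite_II N).
exists (\max_(n <- s) n).+1 => n /= ns.
by rewrite ltnS (@leq_bigmax_seq _ s xpredT id).
Qed.

Lemma infinite_natP (A : set nat) :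
  infinite_set A <-> forall N, exists2 n, A n & N <= n.
Proof.
split=> [iA N|iA /finite_natP[N AN]]; last first.
  by have [n /AN] := iA N; rewrite ltnNge => /negP.
apply: contrapT => noA; apply: iA; apply/finite_natP; exists N => n An.
by rewrite ltnNge; apply/negP => Nn; apply: noA; exists n.
Qed.

(** * Pseudointersections and domination below p *)

Lemma card_lt_pS T (A B : set T) : A `<=` B -> card_lt_p B -> card_lt_p A.
Proof.
move=> AB [F pF [BF nFB]]; exists F => //; split.
  exact: card_le_trans (subset_card_le AB) BF.
by move=> FA; apply: nFB; exact: card_le_trans FA (subset_card_le AB).
Qed.

(** Otherwise the image of [S] under [X] would have sfip without a pseudointersection, and
    minimality of [F] would give [F #<= S]. *)
Lemma card_lt_p_pseudointersection (T : choiceType) (S : set T)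
    (X : T -> set nat) :
  card_lt_p S ->
  (forall s : seq T, [set` s] `<=` S ->
    infinite_set [set n | forall a, a \in s -> X a n]) ->
  exists H, infinite_set H /\ forall a, S a -> H `<=*` X a.
Proof.
move=> [F [_ Fmin] [_ nFS]] Xinf; apply: contrapT => noH.
apply: nFS; apply: card_le_trans (card_image_le X S); apply: Fmin; split.
  move=> G GX finG [Y0 GY0].
  have [a0 _ _] := GX _ GY0.
  have /choice[c cP] (Y : set nat) : exists a, G Y -> S a /\ X a = Y.
    by case: (pselect (G Y)) => [/GX[a Sa <-]|?]; [exists a|exists a0].
  have /finite_seqP[s sE] := finite_image c finG.
  have sS : [set` s] `<=` S by rewrite -sE => _ [Y /cP[Sc _] <-].
  apply: sub_infinite_set (Xinf _ sS) => n nX Y GY.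
  have [_ <-] := cP _ GY; apply: nX.
  by have : [set` s] (c Y) by rewrite -sE; exists Y.
move=> [H [infH HX]]; apply: noH; exists H; split => // a Sa.
by apply: HX; exists a.
Qed.

(** For infinite [S], let a number code a pair [(k, m)], good for [a] when [m] bounds [g a] up to
    [k]. A pseudointersection of the sets of good codes contains codes with [k] at least [n], and
    [h n] is the [m] of one of them. *)
Lemma card_lt_p_dominated (T : choiceType) (S : set T) (g : T -> nat -> nat) :
  card_lt_p S ->
  exists h : nat -> nat,
    forall a, S a -> exists N, forall n, N <= n -> g a n <= h n.
Proof.
move=> Sp; case: (pselect (finite_set S)) => [/finite_seqP[s SE]|].
  exists (fun n => \max_(a <- s) g a n) => a; rewrite SE /= => sa.
  by exists 0 => n _; apply: (@leq_bigmax_seq _ s xpredT (fun b => g b n)).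
move=> /infiniteP/card_leP[f].
pose e n : T := val (f (to_setT n)).
have e_inj : injective e.
  by move=> i j /val_inj/inj; rewrite !in_setT => /(_ isT isT)/(congr1 val).
have eS n : S (e n) by apply: set_mem; exact: valP (f (to_setT n)).
pose u c : nat * nat := odflt (0, 0) (unpickle c).
have uK k m : u (pickle (k, m)) = (k, m) by rewrite /u pickleK.
(* The infinite set [S] also enumerates the countably many conditions
   [n <= (u c).1], so that the family need not be enlarged by them. *)
pose U a := [set c | (forall i, i <= (u c).1 -> g a i <= (u c).2) /\
                     (forall n, e n = a -> n <= (u c).1)].
have [|H [/infinite_natP infH HU]] := @card_lt_p_pseudointersection _ S U Sp.
  move=> s sS; have [K KP] : exists K, forall a n, a \in s -> e n = a -> n < K.
    have /finite_natP[K KP] : finite_set (e @^-1` [set` s]).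
      by apply: finite_preimage (finite_seq s) => i j _ _; apply: e_inj.
    by exists K => a n sa ena; apply: KP; rewrite /= ena.
  pose b k := \max_(a <- s) \max_(i < k.+1) g a i.
  have bP a i k : a \in s -> i <= k -> g a i <= b k.
    move=> sa; rewrite -ltnS => ik.
    apply: leq_trans
      (@leq_bigmax_seq _ s xpredT (fun a => \max_(i < k.+1) g a i) a sa isT).
    exact: (@leq_bigmax _ (fun i : 'I_k.+1 => g a i) (Ordinal ik)).
  (* The shift by [K] exceeds every index that [e] maps into [s], so these codes lie in [U a] for
     all [a] in [s]. *)
  have finj : injective (fun k => pickle (k + K, b (k + K))).
    by move=> i j /(congr1 u); rewrite !uK => -[/addIn].
  move=> /(finite_preimage (in2W finj)); apply/infinite_natP => N.
  exists N => // a sa; rewrite /U /= uK /=; split=> [i|n ena]; first exact: bP.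
  by apply: leq_trans (leq_addl _ _); exact/ltnW/(KP a).
have HK n : exists2 c, H c & n <= (u c).1.
  have /finite_natP[N HN] := HU (e n) (eS n).
  have [c Hc Nc] := infH N; exists c => //; apply: contrapT => nc.
  have /HN : (H `\` U (e n)) c by split=> // -[_ /(_ n erefl)].
  by rewrite ltnNge Nc.
have /choice[h hP] n : exists m, exists2 c, H c & n <= (u c).1 /\ (u c).2 = m.
  by have [c Hc nc] := HK n; exists (u c).2, c.
exists h => a Sa; have /finite_natP[N HN] := HU a Sa.
(* Every code in [H] outside [U a] is below [N]; for [n] at least [K] the code chosen for [n] cannot
   be one of them. *)
have /finite_natP[K KP] : finite_set ((fun c => (u c).1) @` `I_N).
  exact: finite_image (finite_II N).
exists K => n Kn; have [c Hc [nc <-]] := hP n.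
have [Uc _] : U a c.
  apply: contrapT => nUc; have cN : c < N by exact: HN.
  by have := leq_trans Kn nc; rewrite leqNgt KP //; exists c.
exact: Uc.
Qed.

(** * Embeddings and bijections up to finite errors *)

(* Each [n] is sent into a pseudointersection of the sets that [n] demands,
   beyond a bound that dominates all the finite errors. *)
Lemma almost_embedding (T : choiceType) (S : set T) (X Y : T -> set nat) :
  card_lt_p S ->
  (forall s : seq T, [set` s] `<=` S ->
    forall n, infinite_set [set m | forall a, a \in s -> X a n <-> Y a m]) ->
  exists2 p : nat -> nat, injective p &
    forall a, S a -> finite_set [set n | ~ (X a n <-> Y a (p n))].
Proof.
move=> Sp XY.
have /choice[H HP] n : exists H, infinite_set H /\
    forall a, S a -> H `<=*` [set m | X a n <-> Y a m].
  apply: (@card_lt_p_pseudointersection _ _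
    (fun a => [set m | X a n <-> Y a m])).
    exact: Sp.
  by move=> s sS; exact: XY.
(* [g (a, n)] is a threshold past which all of [H n] meets the demand of [n] at [a]; it is arbitrary
   for [a] outside [S]. *)
have /choice[g gP] (an : T * nat) : exists N, S an.1 -> forall m,
    H an.2 m -> N <= m -> (X an.1 an.2 <-> Y an.1 m).
  case: an => a n /=; case: (pselect (S a)) => [Sa|]; last by exists 0.
  have /finite_natP[N NP] := (HP n).2 a Sa; exists N => _ m Hm Nm.
  by apply: contrapT => nXY; have := NP _ (conj Hm nXY); rewrite ltnNge Nm.
have [h hP] := card_lt_p_dominated (fun a n => g (a, n)) Sp.
have /choice[c cP] (nb : nat * nat) : exists m,
    H nb.1 m /\ maxn (h nb.1) nb.2 <= m.
  by have /infinite_natP/(_ (maxn (h nb.1) nb.2))[m] := (HP nb.1).1; exists m.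
(* The second argument of [c] is a lower bound that makes [p] strictly increasing, hence
   injective. *)
pose p := fix p n := c (n, if n is k.+1 then (p k).+1 else 0).
have pP n : H n (p n) /\ h n <= p n.
  case: n => [|n]; first by have /= [] := cP (0, 0); rewrite maxn0.
  by have /= [Hp] := cP (n.+1, (p n).+1); rewrite geq_max => /andP[].
have p_lt n : p n < p n.+1.
  by have /= [_] := cP (n.+1, (p n).+1); rewrite geq_max => /andP[].
exists p.
  have p_mono : {homo p : i j / i < j}.
    by apply: homo_ltn => //; exact: ltn_trans.
  move=> i j pij; by case: (ltngtP i j) => // /p_mono; rewrite pij ltnn.
move=> a Sa; apply/finite_natP; have [N NP] := hP a Sa; exists N => n /= nXY.
rewrite ltnNge; apply/negP => Nn; apply: nXY; have [Hp hp] := pP n.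
by apply: (gP (a, n)) => //=; apply: leq_trans (NP n Nn) hp.
Qed.

(* Banach's form of the Cantor-Bernstein theorem: the bijection is assembled
   from pieces of [p] and of the inverse of [q]. *)
Lemma Cantor_Bernstein_graph (T U : Type) (p : T -> U) (q : U -> T) :
  injective p -> injective q ->
  exists2 r : T -> U, bijective r & forall x, r x = p x \/ q (r x) = x.
Proof.
move=> p_inj q_inj.
(* [C] consists of the forward orbits of the points missed by [q]. On it [r] follows [p]; off it
   every point has a preimage under [q]. *)
pose C x := exists k y, ~ range q y /\ x = iter k (q \o p) y.
have CS x : C (q (p x)) -> C x.
  move=> [[|k] [y [nqy]]] /=; first by move=> E; case: nqy; exists (p x).
  by move=> /q_inj/p_inj ->; exists k, y.
have /choice[r rP] x : exists y, if `[< C x >] then y = p x else q y = x.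
  case: asboolP => [|nC]; first by exists (p x).
  apply: contrapT => nq; apply: nC; exists 0, x; split => //.
  by move=> [y _ qy]; apply: nq; exists y.
exists r; last by move=> x; have := rP x; case: ifP => _; [left|right].
have r_inj : injective r.
  move=> x y rxy; have := rP x; have := rP y; rewrite -rxy.
  case: asboolP => Cy; case: asboolP => Cx.
  - by move=> -> /p_inj.
  - by move=> -> E; case: Cx; rewrite -E; have [k [z [nz ->]]] := Cy;
      exists k.+1, z.
  - by move=> E F; case: Cy; rewrite -E F; have [k [z [nz ->]]] := Cx;
      exists k.+1, z.
  - by move=> <- ->.
have r_surj y : exists x, r x = y.
  have := rP (q y); case: asboolP => [[[|k] [z [nz E]]] _|_ /q_inj <-].
  - by case: nz; exists y.
  - exists (iter k (q \o p) z); have := rP (iter k (q \o p) z).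
    case: asboolP => [_ ->|nC]; first by apply: q_inj; rewrite E.
    by case: nC; exists k, z.
  - by exists (q y).
have /choice[s sP] := r_surj.
by exists s => // x; apply: r_inj; rewrite sP.
Qed.

Lemma almost_bijection (T : choiceType) (S : set T) (X Y : T -> set nat) :
  card_lt_p S ->
  (forall s : seq T, [set` s] `<=` S ->
    forall n, infinite_set [set m | forall a, a \in s -> X a n <-> Y a m]) ->
  (forall s : seq T, [set` s] `<=` S ->
    forall n, infinite_set [set m | forall a, a \in s -> Y a n <-> X a m]) ->
  exists2 r : nat -> nat, bijective r &
    forall a, S a -> finite_set [set n | ~ (X a n <-> Y a (r n))].
Proof.
move=> Sp XY YX.
have [p p_inj pP] := almost_embedding Sp XY.
have [q q_inj qP] := almost_embedding Sp YX.
have [r r_bij rP] := Cantor_Bernstein_graph p_inj q_inj.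
exists r => // a Sa.
(* An error of [r] at [n] is an error of [p] at [n], or [n = q (r n)] and [q] errs at [r n]. *)
apply: (@sub_finite_set _ _ ([set n | ~ (X a n <-> Y a (p n))] `|`
    q @` [set m | ~ (Y a m <-> X a (q m))])); last first.
  by rewrite finite_setU; split; [exact: pP|apply/finite_image/qP].
move=> n /= nXY; case: (rP n) => rn; [left; rewrite -rn //|right].
by exists (r n) => //=; rewrite rn => -[? ?]; apply: nXY.
Qed.

(** * Independence in terms of representatives and under isomorphism *)

Lemma meet_pi (T : eqType) (X : T -> set nat) (s : seq T) :
  (\meet_(x <- s) \pi_Pfin (X x))%O =
  \pi_Pfin [set n | forall x, x \in s -> X x n].
Proof.
elim: s => [|a s IHs].
  by rewrite big_nil Pfin_topE; congr (\pi_Pfin _); apply/seteqP; split.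
rewrite big_cons IHs Pfin_meetE; congr (\pi_Pfin _); apply/seteqP; split=> n /=.
  by move=> [Xan Xn] x; rewrite inE => /orP[/eqP->//|]; exact: Xn.
by move=> Xn; split=> [|x xs]; apply: Xn; rewrite inE ?eqxx ?xs ?orbT.
Qed.

(** A membership pattern is a Boolean combination, and a nonzero class has only infinite
    representatives. [g] will be the identity or the isomorphism. *)
Lemma independent_infinite (S : set Pfin) (g : Pfin -> Pfin) :
  (forall s t : seq Pfin, uniq (s ++ t) -> (forall x, x \in s ++ t -> S x) ->
    ((\meet_(x <- s) g x) `&` (\meet_(x <- t) ~` g x))%O != \bot%O) ->
  forall s : seq Pfin, [set` s] `<=` S -> forall P : Pfin -> Prop,
    infinite_set [set n | forall a, a \in s -> P a <-> repr (g a) n].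
Proof.
move=> gS s sS P finP.
(* Independence concerns distinct members, so duplicates go before [s] is split by [P]. *)
pose u := [seq a <- undup s | `[< P a >]].
pose v := [seq a <- undup s | ~~ `[< P a >]].
have : ((\meet_(x <- u) g x) `&` (\meet_(x <- v) ~` g x))%O != \bot%O.
  have uv : perm_eq (u ++ v) (undup s) by rewrite perm_filterC.
  apply: gS; first by rewrite (perm_uniq uv) undup_uniq.
  by move=> x; rewrite (perm_mem uv) mem_undup; exact: sS.
move/eqP; apply.
have -> : (\meet_(x <- u) g x)%O = (\meet_(x <- u) \pi_Pfin (repr (g x)))%O.
  by apply: eq_bigr => x _; rewrite reprK.
have -> : (\meet_(x <- v) ~` g x)%O =
    (\meet_(x <- v) \pi_Pfin (~` repr (g x)))%O.
  by apply: eq_bigr => x _; rewrite -Pfin_complE reprK.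
rewrite !meet_pi Pfin_meetE Pfin_botE; apply/Pfin_eqP; split; last first.
  by rewrite /almost_subset set0D.
apply: sub_finite_set finP => n [[un vn] _] a sa; split=> [Pa|gan].
  by apply: un; rewrite mem_filter mem_undup sa andbT; apply/asboolP.
apply: contrapT => nPa; apply: (vn a) gan.
by rewrite mem_filter mem_undup sa andbT; apply/asboolPn.
Qed.

Section Isomorphism.
Variables (d1 d2 : Order.disp_t) (T1 : ctbDistrLatticeType d1).
Variables (T2 : ctbDistrLatticeType d2) (A : set T1) (B : set T2).
Variable f : T1 -> T2.
Hypotheses (hA : subalgebra A) (hf : subalgebra_isomorphism A B f).

Lemma subalgebra_meet (I : eqType) (s : seq I) (h : I -> T1) :
  (forall i, i \in s -> A (h i)) -> A (\meet_(i <- s) h i)%O.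
Proof.
move=> hs; rewrite big_seq; elim/big_ind: _ => //.
  exact: subalgebra1 hA.
exact: subalgebraI hA.
Qed.

Lemma iso_meet (I : eqType) (s : seq I) (h : I -> T1) :
  (forall i, i \in s -> A (h i)) ->
  f (\meet_(i <- s) h i)%O = (\meet_(i <- s) f (h i))%O.
Proof.
elim: s => [|i s IHs] hs; first by rewrite !big_nil (subalgebra_iso1 hf).
have hs' j : j \in s -> A (h j) by move=> js; apply: hs; rewrite inE js orbT.
rewrite !big_cons (subalgebra_isoI hf) ?IHs //; last exact: subalgebra_meet.
by apply: hs; rewrite inE eqxx.
Qed.

(** The combination of images is the image of a nonzero combination, and [f] is injective on [A]
    with [f] of bottom equal to bottom. *)
Lemma iso_independent (S : set T1) : S `<=` A -> independent S ->
  forall s t : seq T1, uniq (s ++ t) -> (forall x, x \in s ++ t -> S x) ->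
    ((\meet_(x <- s) f x) `&` (\meet_(x <- t) ~` f x))%O != \bot%O.
Proof.
move=> SA Sind s t ust stS; have := Sind s t ust stS.
have sA x : x \in s -> A x by move=> xs; apply/SA/stS; rewrite mem_cat xs.
have tA x : x \in t -> A x.
  by move=> xt; apply/SA/stS; rewrite mem_cat xt orbT.
have tAC x : x \in t -> A (~` x)%O by move=> /tA; exact: (subalgebraC hA).
have AsA := subalgebra_meet sA; have AtA := subalgebra_meet tAC.
have -> : (\meet_(x <- t) ~` f x)%O = f (\meet_(x <- t) ~` x)%O.
  rewrite iso_meet // !big_seq; apply: eq_bigr => x /tA Ax.
  by rewrite (subalgebra_isoC hf).
rewrite -iso_meet // -(subalgebra_isoI hf) // -(subalgebra_iso0 hf).
apply: contraNN => /eqP; have [_ finj _] := subalgebra_iso_bij hf.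
move/(finj _ _ (mem_set _) (mem_set _)) => -> //; last exact: subalgebra0 hA.
exact: (subalgebraI hA).
Qed.

End Isomorphism.

(** * From the basis to the whole subalgebra *)

Theorem lemma1 (A B : set Pfin) (f : Pfin -> Pfin)
  (hA : subalgebra A) (hB : subalgebra B)
  (hf : subalgebra_isomorphism A B f)
  (hcard : card_lt_p A)
  (hbasis : exists S : set Pfin, independent_basis A S) :
  exists p : nat -> nat, generated_by_permutation A f p.
Proof.
have [S [SA Sind genS]] := hbasis.
have fS := independent_infinite (iso_independent hA hf SA Sind).
have [p p_bij pS] := almost_bijection (card_lt_pS SA hcard)
  (fun s sS n => @fS s sS (fun a => repr a n))
  (fun s sS n => @independent_infinite S id Sind s sS (fun a => repr (f a) n)).
have [q pK qK] := p_bij.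
have pE X : p @` X = q @^-1` X.
  apply/seteqP; split=> [_ [n Xn <-]|m Xm]; first by rewrite /= pK.
  by exists (q m).
have q_fin D : finite_set D -> finite_set (q @^-1` D).
  by apply: finite_preimage => i j _ _; exact: (can_inj qK).
(* The map induced by [p] on classes, written with preimages under its inverse [q] since these
   commute with all Boolean operations. *)
pose F (a : Pfin) := \pi_Pfin (q @^-1` repr a).
have FE X : F (\pi_Pfin X) = \pi_Pfin (q @^-1` X).
  have /Pfin_eqP[XX' X'X] : \pi_Pfin (repr (\pi_Pfin X)) = \pi_Pfin X.
    exact: reprK.
  by apply/Pfin_eqP; split; [exact: q_fin XX'|exact: q_fin X'X].
suff Ff a : A a -> F a = f a.
  by exists p; split=> // a X Aa XE; rewrite -Ff // -XE FE pE //.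
rewrite -genS; move: a.
(* [A a] is carried along because [f] respects the operations only on [A]. *)
suff : generated_subalgebra S `<=` [set a | A a /\ F a = f a].
  by move=> GS a /GS[].
apply: smallest_sub; last first.
  move=> a Sa; split; first exact: SA.
  rewrite -[f a]reprK; apply/Pfin_eqP.
  have := q_fin _ (pS a Sa) => fin_a.
  split; apply: sub_finite_set fin_a => m /= [h1 h2]; rewrite qK => -[h3 h4].
    by apply: h2; exact: h3.
  by apply: h2; exact: h4.
split.
- split; first exact: subalgebra0 hA.
  by rewrite (subalgebra_iso0 hf) Pfin_botE FE.
- split; first exact: subalgebra1 hA.
  by rewrite (subalgebra_iso1 hf) Pfin_topE FE.
- move=> x y [Ax Fx] [Ay Fy]; split; first exact: (subalgebraI hA).
  by rewrite (subalgebra_isoI hf) // -Fx -Fy -[x]reprK -[y]reprK Pfin_meetE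
    !FE Pfin_meetE.
- move=> x y [Ax Fx] [Ay Fy]; split; first exact: (subalgebraU hA).
  by rewrite (subalgebra_isoU hf) // -Fx -Fy -[x]reprK -[y]reprK Pfin_joinE
    !FE Pfin_joinE.
- move=> x [Ax Fx]; split; first exact: (subalgebraC hA).
  by rewrite (subalgebra_isoC hf) // -Fx -[x]reprK Pfin_complE !FE Pfin_complE.
Qed.
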